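(* Let $G$ be a finite group, $\omega\in Z^3(G,\mathbb{C}^\times)$ a (normalized) 3-cocycle, and let $L(H,\gamma)$ be a Lagrangian algebra in $\mathcal{Z}(\operatorname{Vec}_G^\omega)$. Then $L(H,\gamma)$ with the decomposition $$L(H,\gamma)=\bigoplus_{(g,h)\in G\times_H H}\mathbb{C}\chi_{g,h}$$ is a monomial twisted Yetter-Drinfeld module.
   Context: Twisted Yetter-Drinfeld modules. Let $e$ be the identity of $G$ and ${}^gh=ghg^{-1}$. A normalized 3-cocycle is a map $\omega:G\times G\times G\to\mathbb{C}^\times$ with $\omega(ab,c,d)\,\omega(a,b,cd)=\omega(a,b,c)\,\omega(a,bc,d)\,\omega(b,c,d)$ and $\omega(a,e,b)=1$. Put $$\omega(g,g';h)=\frac{\omega({}^{gg'}h,g,g')\,\omega(g,g',h)}{\omega(g,{}^{g'}h,g')}.$$ An object of $\mathcal{Z}(\operatorname{Vec}_G^\omega)$ (a twisted Yetter-Drinfeld module) is a $G$-graded vector space $V=\bigoplus_{g\in G}V_g$ with linear maps $v\mapsto g\triangleright v$ ($g\in G$), the twisted $G$-action, such that $e\triangleright v=v$, $(gh)\triangleright v=\omega(g,h;k)\,(g\triangleright(h\triangleright v))$ for $v\in V_k$, and $g\triangleright V_h\subseteq V_{ghg^{-1}}$. We write $|v|=k$ for $v\in V_k$. A monomial twisted Yetter-Drinfeld module is a triple $(V,X,(V_x)_{x\in X})$ where $V\in\mathcal{Z}(\operatorname{Vec}_G^\omega)$ is finite dimensional, $X$ is a finite set, the $V_x$ are one-dimensional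 subspaces with $V=\bigoplus_{x\in X}V_x$, the twisted $G$-action permutes the $V_x$'s, and each $V_x$ is $G$-homogeneous. The Lagrangian algebra $L(H,\gamma)$. Let $H\subseteq G$ be a subgroup and $\gamma:H\times H\to\mathbb{C}^\times$ a map with $\frac{\gamma(ab,c)\gamma(a,b)}{\gamma(a,bc)\gamma(b,c)}=\omega(a,b,c)$ for all $a,b,c\in H$. Let $\mathbb{C}_\gamma[H]=\bigoplus_{h\in H}\mathbb{C}e_h$ with grading $|e_h|=h$ and $$h_1\triangleright e_{h_2}=\epsilon(h_1,h_2)\,e_{h_1h_2h_1^{-1}},\qquad \epsilon(h_1,h_2)=\frac{\gamma(h_1,h_2)}{\gamma({}^{h_1}h_2,h_1)}.$$ On the space of all maps $G\to\mathbb{C}_\gamma[H]$, a map $a$ is homogeneous of degree $|a|=f\in G$ if $a(x)$ is homogeneous of degree $x^{-1}fx$ for all $x\in G$, and the twisted $G$-action is $(g\triangleright a)(x)=\omega(x^{-1},g;|a|)^{-1}\,a(g^{-1}x)$ for homogeneous $a$. Then $L(H,\gamma)$ is the twisted Yetter-Drinfeld submodule spanned by the homogeneous $a$ satisfying $a(xh)=\omega(h^{-1},x^{-1};|a|)\,h^{-1}\triangleright a(x)$ for all $x\in G,h\in H$. The elements $\chi_{g,f}$. For $g\in G,f\in H$, $\chi_{g,f}\in L(H,\gamma)$ is the map with $\chi_{g,f}(x)=0$ for $x\notin gH$ and $\chi_{g,f}(gh)=\omega(h^{-1},g^{-1};{}^gf)\,\epsilon(h^{-1},f)\,e_{h^{-1}fh}$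 for $h\in H$. The index set. $G\times_H H$ is the set of $H$-orbits on $G\times H$ for the action $h\cdot(g,h')=(gh^{-1},hh'h^{-1})$; the line $\mathbb{C}\chi_{g,h}$ depends only on the class of $(g,h)$ in $G\times_H H$. *)

(* Defs.v *)
From HB Require Import structures.
From mathcomp Require Import all_boot all_order all_algebra all_fingroup.
From mathcomp Require Export reals complex.

Set Implicit Arguments.
Unset Strict Implicit.
Unset Printing Implicit Defensive.

Import GroupScope GRing.Theory.
Local Open Scope ring_scope.

(* [lconj g h] is the left conjugate g h g^-1, whereas MathComp's [h ^ g] is
   g^-1 h g. *)
Definition lconj (gT : finGroupType) (g h : gT) : gT := (g * h * g^-1)%g.

(* C^x-valued maps are F-valued maps that never vanish. *)
Record normalized_3cocycle (F : fieldType) (gT : finGroupType)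
    (omega : gT -> gT -> gT -> F) : Prop := Normalized3Cocycle {
  cocycle_neq0 : forall a b c, omega a b c != 0;
  cocycleE : forall a b c d,
    omega (a * b)%g c d * omega a b (c * d)%g =
    omega a b c * omega a (b * c)%g d * omega b c d;
  cocycle_normalized : forall a b, omega a 1%g b = 1 }.

(* omega(g, g'; h) *)
Definition omega2 (F : fieldType) (gT : finGroupType)
    (omega : gT -> gT -> gT -> F) (g g' h : gT) : F :=
  omega (lconj (g * g')%g h) g g' * omega g g' h / omega g (lconj g' h) g'.

Section YetterDrinfeld.
Variables (F : fieldType) (gT : finGroupType) (omega : gT -> gT -> gT -> F).

(* A finite-dimensional twisted Yetter-Drinfeld module, presented as a subspace
   V of an ambient finite-dimensional space W (V = fullv for an absolute one):
   [gr g] is the component V_g, and [act g] restricts to the action of g. *)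
Record twistedYD (W : vectType F) (V : {vspace W})
    (gr : gT -> {vspace W}) (act : gT -> 'End(W)) : Prop := TwistedYD {
  ydV : (\sum_g gr g)%VS = V;
  yd_direct : directv (\sum_g gr g);
  yd_act1 : forall v, v \in V -> act 1%g v = v;
  yd_actM : forall g h k v, v \in gr k ->
    act (g * h)%g v = omega2 omega g h k *: act g (act h v);
  yd_act_gr : forall g h, (act g @: gr h <= gr (lconj g h))%VS }.

Record monomialYD (W : vectType F) (V : {vspace W})
    (gr : gT -> {vspace W}) (act : gT -> 'End(W))
    (X : finType) (line : X -> {vspace W}) : Prop := MonomialYD {
  monYD : twistedYD V gr act;
  mon_dim1 : forall x, \dim (line x) = 1%N;
  monV : (\sum_x line x)%VS = V;
  mon_direct : directv (\sum_x line x);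
  mon_perm : forall g, exists s : {perm X},
    forall x, (act g @: line x)%VS = line (s x);
  mon_homog : forall x, exists g, (line x <= gr g)%VS }.

End YetterDrinfeld.

Section Lagrangian.
Variables (F : fieldType) (gT : finGroupType) (omega : gT -> gT -> gT -> F).
Variables (H : {group gT}) (gamma : [subg H] -> [subg H] -> F).

Record trivializes : Prop := Trivializes {
  trivializes_neq0 : forall a b, gamma a b != 0;
  trivializesE : forall a b c,
    gamma (a * b)%g c * gamma a b / (gamma a (b * c)%g * gamma b c) =
    omega (sgval a) (sgval b) (sgval c) }.

(* C_gamma[H] *)
Definition twgrpalg : vectType F := {ffun [subg H] -> F^o}.

Definition ebasis (h : [subg H]) : twgrpalg := [ffun k => (k == h)%:R].

(* The component of degree g; it is 0 unless g lies in H. *)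
Definition twgrpalg_gr (g : gT) : {vspace twgrpalg} :=
  (\sum_(h | sgval h == g) <[ebasis h]>)%VS.

Definition twgrpalg_proj (g : gT) (v : twgrpalg) : twgrpalg :=
  \sum_(h | sgval h == g) v h *: ebasis h.

Definition epsilon (h1 h2 : [subg H]) : F :=
  gamma h1 h2 / gamma (lconj h1 h2) h1.

Definition twgrpalg_act_fun (h1 : [subg H]) (v : twgrpalg) : twgrpalg :=
  \sum_h2 v h2 *: (epsilon h1 h2 *: ebasis (lconj h1 h2)).

Definition twgrpalg_act (h1 : [subg H]) : 'End(twgrpalg) :=
  linfun (twgrpalg_act_fun h1).

(* The space of all maps G -> C_gamma[H]. *)
Definition maps : vectType F := {ffun gT -> twgrpalg}.

Definition ev_fun (x : gT) (a : maps) : twgrpalg := a x.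

Definition ev (x : gT) : 'Hom(maps, twgrpalg) := linfun (ev_fun x).

(* [f ^ x] is x^-1 f x. *)
Definition maps_gr (f : gT) : {vspace maps} :=
  (\bigcap_x (ev x @^-1: twgrpalg_gr (f ^ x)%g))%VS.

Definition maps_proj (f : gT) (a : maps) : maps :=
  [ffun x => twgrpalg_proj (f ^ x)%g (a x)].

(* The action is prescribed on homogeneous maps; a general map is the sum of
   its components [maps_proj f a] (see [maps_actE] below). *)
Definition maps_act_fun (g : gT) (a : maps) : maps :=
  \sum_f [ffun x : gT =>
    (omega2 omega x^-1%g g f)^-1 *: maps_proj f a (g^-1 * x)%g].

Definition maps_act (g : gT) : 'End(maps) := linfun (maps_act_fun g).

(* The homogeneous elements of degree f of L(H, gamma); see [lagr_grP]. *)
Definition lagr_gr (f : gT) : {vspace maps} :=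
  (maps_gr f :&:
   \bigcap_x \bigcap_h
     lker (ev (x * sgval h)%g -
           omega2 omega (sgval h)^-1%g x^-1%g f *:
             (twgrpalg_act h^-1%g \o ev x)%VF))%VS.

Definition lagr : {vspace maps} := (\sum_f lagr_gr f)%VS.

(* For x = g h, the element h of H is g^-1 x. *)
Definition chi (g : gT) (f : [subg H]) : maps :=
  [ffun x => if x \in (g *: H)%g then
     let h := subg H (g^-1 * x)%g in
     (omega2 omega (sgval h)^-1%g g^-1%g (lconj g (sgval f)) *
        epsilon h^-1%g f) *: ebasis (h^-1 * f * h)%g
   else 0].

Definition GH_act (h : [subg H]) (p : gT * [subg H]) : gT * [subg H] :=
  ((p.1 * (sgval h)^-1)%g, lconj h p.2).

Definition GH_orbit (p : gT * [subg H]) : {set gT * [subg H]} :=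
  [set GH_act h p | h in [set: [subg H]]].

(* G x_H H *)
Definition GxH : finType :=
  {O : {set gT * [subg H]} | O \in [set GH_orbit p | p in [set: gT * [subg H]]]}.

Definition GH_class (g : gT) (h : [subg H]) : GxH :=
  exist _ (GH_orbit (g, h)) (imset_f GH_orbit (in_setT (g, h))).

(* The line C chi_(g,h) of the class of (g, h), written without choosing a
   representative: the sum of the lines of all representatives. *)
Definition chi_line (O : GxH) : {vspace maps} :=
  (\sum_(p in val O) <[chi p.1 p.2]>)%VS.

(* The maps wrapped by [linfun] are linear, and the linear subspaces and maps
   above satisfy the element-wise conditions that they encode. *)

Fact twgrpalg_act_fun_linear h : linear (twgrpalg_act_fun h).
Proof.
move=> c u v; rewrite /twgrpalg_act_fun scaler_sumr -big_split /=.
by apply: eq_bigr => k _; rewrite !ffunE scalerDl !scalerA.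
Qed.

Fact ev_fun_linear x : linear (ev_fun x).
Proof. by move=> c u v; rewrite /ev_fun !ffunE. Qed.

Fact twgrpalg_proj_linear g : linear (twgrpalg_proj g).
Proof.
move=> c u v; rewrite /twgrpalg_proj scaler_sumr -big_split /=.
by apply: eq_bigr => k _; rewrite !ffunE scalerDl scalerA.
Qed.

Fact maps_act_fun_linear g : linear (maps_act_fun g).
Proof.
move=> c u v; rewrite /maps_act_fun scaler_sumr -big_split /=.
apply: eq_bigr => f _; apply/ffunP => x.
by rewrite !ffunE twgrpalg_proj_linear scalerDr !scalerA mulrC.
Qed.

HB.instance Definition _ h :=
  GRing.isLinear.Build F twgrpalg twgrpalg _ (twgrpalg_act_fun h)
    (twgrpalg_act_fun_linear h).
HB.instance Definition _ x :=
  GRing.isLinear.Build F maps twgrpalg _ (ev_fun x) (ev_fun_linear x).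
HB.instance Definition _ g :=
  GRing.isLinear.Build F maps maps _ (maps_act_fun g) (maps_act_fun_linear g).

Lemma evE x a : ev x a = a x.
Proof. by rewrite lfunE. Qed.

Lemma twgrpalg_actE h1 h2 :
  twgrpalg_act h1 (ebasis h2) = epsilon h1 h2 *: ebasis (lconj h1 h2).
Proof.
rewrite lfunE /= /twgrpalg_act_fun (bigD1 h2) //= ffunE eqxx scale1r.
rewrite big1 ?addr0 // => k /negbTE kh; by rewrite ffunE kh scale0r.
Qed.

Lemma maps_grP f (a : maps) :
  reflect (forall x, a x \in twgrpalg_gr (f ^ x)%g) (a \in maps_gr f).
Proof.
rewrite /maps_gr memvE; apply: (iffP subv_bigcapP) => aP x.
  by have := aP x isT; rewrite -memvE -memv_preim evE.
by rewrite -memvE -memv_preim evE.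
Qed.

Lemma twgrpalg_grP g (v : twgrpalg) :
  reflect (forall h, sgval h != g -> v h = 0) (v \in twgrpalg_gr g).
Proof.
apply: (iffP memv_sumP) => [[u uP ->] h hg | v0].
  rewrite sum_ffunE big1 // => k /eqP kg.
  have /vlineP[c ->] := uP k (introT eqP kg).
  rewrite !ffunE; have [hk | _] := eqVneq h k; last by rewrite scaler0.
  by rewrite hk kg eqxx in hg.
exists (fun h => v h *: ebasis h) => [h _|]; first exact/memvZ/memv_line.
apply/ffunP => h; rewrite sum_ffunE.
have [hg | /v0 vh0] := boolP (sgval h == g).
  rewrite (bigD1 h) //= !ffunE eqxx big1 => [|k /andP[_ /negbTE kh]].
    by rewrite addr0 /GRing.scale /= mulr1.
  by rewrite !ffunE eq_sym kh scaler0.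
rewrite vh0 big1 // => k kg; rewrite !ffunE.
by case: eqP => [hk | _]; rewrite ?scaler0 // -hk vh0 scale0r.
Qed.

Lemma twgrpalg_projE g (v : twgrpalg) h :
  twgrpalg_proj g v h = if sgval h == g then v h else 0.
Proof.
rewrite /twgrpalg_proj sum_ffunE; case: ifPn => hg.
  rewrite (bigD1 h) //= !ffunE eqxx big1 => [|k /andP[_ /negbTE kh]].
    by rewrite addr0 /GRing.scale /= mulr1.
  by rewrite !ffunE eq_sym kh scaler0.
rewrite big1 // => k kg; rewrite !ffunE.
have [hk | _] := eqVneq h k; last by rewrite scaler0.
by rewrite hk kg in hg.
Qed.

Lemma maps_actE g f a x : a \in maps_gr f ->
  maps_act g a x = (omega2 omega x^-1%g g f)^-1 *: a (g^-1 * x)%g.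
Proof.
move=> /maps_grP aP; rewrite lfunE /= /maps_act_fun sum_ffunE (bigD1 f) //=.
rewrite big1 => [|k kf]; rewrite !ffunE.
  rewrite addr0; congr (_ *: _); apply/ffunP => h; rewrite twgrpalg_projE.
  by case: ifPn => // /(twgrpalg_grP _ _ (aP _)) ->.
suff -> : twgrpalg_proj (k ^ (g^-1 * x)) (a (g^-1 * x)%g) = 0 by rewrite scaler0.
apply/ffunP => h; rewrite twgrpalg_projE [RHS]ffunE; case: eqP => // hk.
apply: (twgrpalg_grP _ _ (aP _)); rewrite hk.
by apply: contra kf => /eqP/conjg_inj->.
Qed.

Lemma lagr_grP f (a : maps) :
  reflect (a \in maps_gr f /\ forall x h, a (x * sgval h)%g =
             omega2 omega (sgval h)^-1%g x^-1%g f *: twgrpalg_act h^-1%g (a x))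
          (a \in lagr_gr f).
Proof.
rewrite /lagr_gr memv_cap; apply: (iffP andP) => -[af aP]; split=> //.
  move=> x h; move: aP; rewrite memvE => /subv_bigcapP/(_ x isT).
  move/subv_bigcapP/(_ h isT); rewrite -memvE memv_ker.
  by rewrite add_lfunE opp_lfunE scale_lfunE comp_lfunE !evE subr_eq0 => /eqP.
rewrite memvE; apply/subv_bigcapP => x _; apply/subv_bigcapP => h _.
rewrite -memvE memv_ker.
by rewrite add_lfunE opp_lfunE scale_lfunE comp_lfunE !evE subr_eq0 aP.
Qed.

Lemma chiE g f (h : [subg H]) : chi g f (g * sgval h)%g =
  (omega2 omega (sgval h)^-1%g g^-1%g (lconj g (sgval f)) * epsilon h^-1%g f)
    *: ebasis (h^-1 * f * h)%g.
Proof. by rewrite ffunE mem_lcoset mulKg subgP /= sgvalK. Qed.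

End Lagrangian.

Arguments maps_gr {F gT H} f.
Arguments maps_act {F gT} omega {H} g.

(* Main.v *)
Require Import Defs.
From mathcomp Require Import all_boot all_order all_algebra all_fingroup reals complex.
From mathcomp Require Import ring.

Set Implicit Arguments.
Unset Strict Implicit.
Unset Printing Implicit Defensive.

Import GroupScope GRing.Theory.
Local Open Scope ring_scope.

(** A map in L(H, gamma) that is homogeneous of degree k satisfies an
    equivariance condition under right translation by H, so on a left coset
    g H it is determined by its value at g.  That value is homogeneous of degree
    g^-1 k g, hence a multiple of the basis vector e_f if f = g^-1 k g lies in
    H, and 0 otherwise.  Since chi_(g, f) is homogeneous of degree g f g^-1,
    supported on g H, and takes the value e_f at g, a homogeneous element
    supported on g H is a multiple of some chi_(g, f) ([lagr_gr_chi],
    [restrict_lagr_line]).  The theorem follows from this uniqueness: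

    - chi_(g h^-1, h f h^-1) has the same degree and support as chi_(g, f), so
      the two are proportional and the line depends only on the class of (g, f)
      ([chi_lineE]);
    - cutting a homogeneous element along the left cosets of H writes it as a
      sum of multiples of the chi's, so the lines span ([chi_line_sum]);
    - the action of p sends chi_(g, f) to an element of degree p g f (p g)^-1
      supported on p g H, so to a multiple of chi_(p g, f), which is nonzero at
      p g: the lines are permuted ([maps_act_chi]).

    The lines are independent because the coefficient of e_f in the value at g
    vanishes on every chi_(g', f') outside the class of (g, f) ([chi_coord],
    [chi_line_independent]).

    That chi_(g, f) lies in L(H, gamma), that L(H, gamma) is stable, and that
    the action is a twisted action all follow from one identity, the
    twisted 2-cocycle property of omega(g, g'; h) ([omega2_cocycle]), together
    with the fact that gamma, as a trivialization of omega on H, makes epsilon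
    multiplicative up to omega(g, g'; h) ([epsilonM]).  All this holds over an
    arbitrary field. *)

(** * The transgressed cocycle omega(g, g'; h) *)

Section Cocycle.
Variables (F : fieldType) (gT : finGroupType) (omega : gT -> gT -> gT -> F).
Hypothesis omegaP : normalized_3cocycle omega.
Implicit Types g h k l x : gT.

Local Notation w2 := (omega2 omega).

Lemma lconjM g h k : lconj (g * h)%g k = lconj g (lconj h k).
Proof. by rewrite /lconj invMg !mulgA. Qed.

Lemma lconj_mulg g k : (lconj g k * g = g * k)%g.
Proof. exact: mulgKV. Qed.

Lemma conjg_lconj g h k : (lconj g h ^ k = h ^ (g^-1 * k))%g.
Proof. by rewrite conjgM (conjgE h g^-1) invgK mulgA. Qed.

Lemma cocycle1l h k : omega 1%g h k = 1.
Proof.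
have := cocycleE omegaP 1%g 1%g h k.
rewrite !mul1g !(cocycle_normalized omegaP) mulr1 mul1r => /esym.
by rewrite -[RHS]mulr1; apply: mulfI; apply: cocycle_neq0.
Qed.

Lemma cocycle1r g h : omega g h 1%g = 1.
Proof.
have := cocycleE omegaP g h 1%g 1%g.
rewrite !mulg1 !(cocycle_normalized omegaP) mul1r mulr1 -[LHS]mul1r => /esym.
by apply: mulIf; apply: cocycle_neq0.
Qed.

Lemma omega2_neq0 g h k : w2 g h k != 0.
Proof. by rewrite /omega2 !mulf_neq0 ?invr_neq0 // cocycle_neq0. Qed.

Lemma omega2_1l g k : w2 1%g g k = 1.
Proof.
by rewrite /omega2 (cocycle_normalized omegaP) !cocycle1l !mul1r invr1.
Qed.

Lemma omega2_1r g k : w2 g 1%g k = 1.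
Proof.
by rewrite /omega2 (cocycle_normalized omegaP) !cocycle1r !mul1r invr1.
Qed.

(** The condition for a twisted action by omega(-, -; -) to be associative: both
    sides compare the action of g h l on degree k with the successive actions
    of l, h and g.  It is the alternating product of the 3-cocycle relations at
    the four positions of the degree among g, h, l. *)
Lemma omega2_cocycle g h l k :
  w2 (g * h)%g l k * w2 g h (lconj l k) = w2 g (h * l)%g k * w2 h l k.
Proof.
rewrite /omega2 !lconjM.
set k1 := lconj l k; set k2 := lconj h k1; set k3 := lconj g k2.
have nz := cocycle_neq0 omegaP.
have e1 := cocycleE omegaP k3 g h l.
have e2 := cocycleE omegaP g k2 h l.
have e3 := cocycleE omegaP g h k1 l.
have e4 := cocycleE omegaP g h l k.
rewrite !lconj_mulg in e1 e2 e3.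
(* Each relation is solved for one factor, chosen so that substituting e1, ...,
   e4 in order eliminates it and leaves a rational identity. *)
have {}e1 : omega k3 (g * h)%g l = omega (g * k2)%g h l * omega k3 g (h * l)%g
    / (omega k3 g h * omega g h l).
  by rewrite e1; field; rewrite !nz.
have {}e2 : omega (g * k2)%g h l = omega g k2 h * omega g (h * k1)%g l
    * omega k2 h l / omega g k2 (h * l)%g.
  by rewrite -e2; field; rewrite !nz.
have {}e3 : omega (g * h)%g k1 l = omega g h k1 * omega g (h * k1)%g l
    * omega h k1 l / omega g h (l * k)%g.
  by rewrite -e3; field; rewrite !nz.
have {}e4 : omega (g * h)%g l k = omega g h l * omega g (h * l)%g k
    * omega h l k / omega g h (l * k)%g.
  by rewrite -e4; field; rewrite !nz.
by rewrite e1 e2 e3 e4; field; rewrite !nz.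
Qed.

End Cocycle.

(** * The index set *)

Section Orbits.
Variables (gT : finGroupType) (H : {group gT}).
Implicit Types (g : gT) (f h : [subg H]).

Lemma GH_act1 (q : gT * [subg H]) : GH_act 1%g q = q.
Proof. by case: q => g f; rewrite /GH_act /lconj /= !invg1 mul1g !mulg1. Qed.

Lemma GH_actM h1 h2 (q : gT * [subg H]) :
  GH_act (h1 * h2)%g q = GH_act h1 (GH_act h2 q).
Proof.
rewrite /GH_act /= lconjM; congr (_, _).
by rewrite (invMg (sgval h1) (sgval h2) : (sgval (h1 * h2))^-1 = _)%g mulgA.
Qed.

(** The orbits of the two pairs coincide as soon as one pair lies in the orbit of
    the other. *)
Lemma GH_classP g f g' f' :
  reflect (exists h, (g', f') = GH_act h (g, f))
          (GH_class g f == GH_class g' f').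
Proof.
apply: (iffP eqP) => [/(congr1 val)/= e | [h e]].
  have /imsetP[h _ ->] : (g', f') \in GH_orbit (g, f) by
    rewrite e; apply/imsetP; exists 1%g; rewrite ?GH_act1 ?inE.
  by exists h.
apply/val_inj/setP => q /=; rewrite e.
apply/imsetP/imsetP => -[k _ ->].
  by exists (k * h^-1)%g; rewrite ?inE // -GH_actM mulgKV.
by exists (k * h)%g; rewrite ?inE // GH_actM.
Qed.

Lemma GH_class_surj (O : GxH H) : exists q, O == GH_class q.1 q.2.
Proof.
have /imsetP[[g f] _ e] := valP O; exists (g, f); apply/eqP/val_inj/e.
Qed.

Definition GH_repr (O : GxH H) := xchoose (GH_class_surj O).

Lemma GH_reprK (O : GxH H) : GH_class (GH_repr O).1 (GH_repr O).2 = O.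
Proof. by rewrite [RHS](eqP (xchooseP (GH_class_surj O))). Qed.

Lemma GH_translate_class p g f g' f' :
  (GH_class (p * g)%g f == GH_class (p * g')%g f') =
  (GH_class g f == GH_class g' f').
Proof.
apply/GH_classP/GH_classP => -[h [e ->]]; exists h; congr (_, _).
  by apply: (mulgI p); rewrite e mulgA.
by rewrite e mulgA.
Qed.

(** Left multiplication by p on the first component; it commutes with the action
    of H on pairs, so the chosen representative does not matter
    ([GH_translateE]). *)
Definition GH_translate p (O : GxH H) : GxH H :=
  GH_class (p * (GH_repr O).1)%g (GH_repr O).2.

Lemma GH_translateE p g f : GH_translate p (GH_class g f) = GH_class (p * g)%g f.
Proof. by apply/eqP; rewrite GH_translate_class GH_reprK. Qed.

Lemma GH_translate_inj p : injective (GH_translate p).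
Proof.
by move=> O O' /eqP; rewrite GH_translate_class !GH_reprK => /eqP.
Qed.

End Orbits.

(** * The trivialization on H *)

Section Lagrangian.
Variables (F : fieldType) (gT : finGroupType) (omega : gT -> gT -> gT -> F).
Hypothesis omegaP : normalized_3cocycle omega.
Variables (H : {group gT}) (gamma : [subg H] -> [subg H] -> F).
Hypothesis gammaP : trivializes omega gamma.
Implicit Types (g k x p : gT) (f h : [subg H]) (a b : maps F H).

Local Notation w2 := (omega2 omega).
Local Notation eps := (epsilon gamma).
Local Notation chi := (chi omega gamma).
Local Notation Lgr := (lagr_gr omega gamma).
Local Notation L := (lagr omega gamma).

(** gamma need not be normalized, but the relation it satisfies at (f, 1, f)
    gives gamma(f, 1) = gamma(1, f). *)
Lemma epsilon1 f : eps 1%g f = 1.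
Proof.
have := trivializesE gammaP f 1%g f.
rewrite (cocycle_normalized omegaP) mulg1 mul1g => /divr1_eq.
have nz := trivializes_neq0 gammaP.
move/(mulfI (nz f f)) => e.
by rewrite /epsilon /lconj mul1g invg1 mulg1 e divff.
Qed.

(** The twisted action of H on its twisted group algebra is associative: writing
    the three values of omega in omega(h1, h2; f) as coboundaries of gamma, all
    the terms that do not occur in epsilon cancel. *)
Lemma epsilonM h1 h2 f :
  eps (h1 * h2)%g f =
  w2 (sgval h1) (sgval h2) (sgval f) * (eps h1 (lconj h2 f) * eps h2 f).
Proof.
rewrite /omega2 lconjM.
set f1 := lconj h2 f; set f2 := lconj h1 f1.
have -> : lconj (sgval h2) (sgval f) = sgval f1 by [].
have -> : lconj (sgval h1) (sgval f1) = sgval f2 by [].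
rewrite -!(trivializesE gammaP) /epsilon lconjM -/f1 -/f2.
rewrite (lconj_mulg h1 f1 : f2 * h1 = _)%g (lconj_mulg h2 f : f1 * h2 = _)%g.
by field; rewrite !(trivializes_neq0 gammaP).
Qed.

(** * The elements chi *)

Lemma lcoset_subgP g x :
  reflect (exists h, x = g * sgval h)%g (x \in g *: H)%g.
Proof.
apply: (iffP lcosetP) => [[y yH ->] | [h ->]]; last by exists (sgval h); rewrite ?subgP.
by exists (subg H y); rewrite subgK.
Qed.

Lemma ebasis_neq0 f : ebasis F f != 0.
Proof.
by apply/eqP => /ffunP/(_ f)/eqP; rewrite !ffunE eqxx oner_eq0.
Qed.

Lemma ebasis_gr f : ebasis F f \in twgrpalg_gr F H (sgval f).
Proof.
by apply/twgrpalg_grP => h; rewrite ffunE (inj_eq val_inj) => /negbTE->.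
Qed.

Lemma twgrpalg_gr_line f (v : twgrpalg F H) :
  v \in twgrpalg_gr F H (sgval f) -> v = v f *: ebasis F f.
Proof.
move/twgrpalg_grP => v0; apply/ffunP => h; rewrite !ffunE.
have [-> | hf] := eqVneq; first by rewrite [RHS]mulr1.
by rewrite scaler0 v0 // (inj_eq val_inj).
Qed.

Lemma chi_rep g f : chi g f g = ebasis F f.
Proof.
have := chiE omega gamma g f 1%g.
by rewrite !invg1 mulg1 omega2_1l // epsilon1 mul1r scale1r mul1g mulg1.
Qed.

Lemma chi_out g f x : x \notin (g *: H)%g -> chi g f x = 0.
Proof. by rewrite ffunE => /negbTE->. Qed.

Lemma chi_neq0 g f : chi g f != 0.
Proof.
apply/eqP => /ffunP/(_ g); rewrite chi_rep ffunE.
exact/eqP/ebasis_neq0.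
Qed.

Lemma lcosetMr g x h : ((x * sgval h)%g \in g *: H)%g = (x \in g *: H)%g.
Proof. by rewrite !mem_lcoset mulgA groupMr ?subgP. Qed.

(** On g H, equivariance from g l to g l h combines the multiplicativity of
    epsilon at (h^-1, l^-1) with the cocycle property at (h^-1, l^-1, g^-1). *)
Lemma chi_lagr g f : chi g f \in Lgr (lconj g (sgval f)).
Proof.
apply/lagr_grP; split=> [|x h]; first apply/maps_grP => x.
  have [/lcoset_subgP[h ->] | /chi_out->] := boolP (x \in (g *: H)%g); last exact: mem0v.
  rewrite chiE memvZ // conjg_lconj mulKg conjgE -mulgA; exact: ebasis_gr.
have [/lcoset_subgP[l ->] | xgH] := boolP (x \in (g *: H)%g); last first.
  by rewrite !chi_out ?lcosetMr // linear0 scaler0.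
rewrite -mulgA (chiE omega gamma g f (l * h)%g) chiE linearZ /= twgrpalg_actE.
rewrite !scalerA; congr (_ *: ebasis _ _); last first.
  by rewrite /lconj !invMg invgK !mulgA.
have := omega2_cocycle omegaP (sgval h)^-1%g (sgval l)^-1%g g^-1%g (lconj g (sgval f)).
rewrite -lconjM mulVg => e.
have l1 : lconj 1%g (sgval f) = sgval f by rewrite /lconj mul1g invg1 mulg1.
rewrite l1 in e.
rewrite (invMg l h) epsilonM (invMg g).
have -> : (l^-1 * f * l = lconj l^-1 f)%g by rewrite /lconj invgK.
rewrite (invMg (sgval l) (sgval h) : (sgval (l * h))^-1 = _)%g.
rewrite mulrA e; ring.
Qed.

(** * The twisted action on maps *)

Lemma maps_act_gr p k a : a \in maps_gr k -> maps_act omega p a \in maps_gr (lconj p k).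
Proof.
move=> ak; apply/maps_grP => x; rewrite (maps_actE _ _ _ ak) memvZ //.
by rewrite conjg_lconj; apply: (elimT (maps_grP _ _) ak).
Qed.

(** Both sides of the equivariance condition are multiples of the same vector;
    the factors agree by the cocycle property at (h^-1, x^-1, p). *)
Lemma maps_act_lagr_gr p k a : a \in Lgr k -> maps_act omega p a \in Lgr (lconj p k).
Proof.
case/lagr_grP=> ak aP; apply/lagr_grP; split=> [|x h]; first exact: maps_act_gr.
rewrite !(maps_actE _ _ _ ak) mulgA aP [in RHS]linearZ /= !scalerA; congr (_ *: _).
have nz := omega2_neq0 omegaP.
have := omega2_cocycle omegaP (sgval h)^-1%g x^-1%g p k.
rewrite !invMg invgK => e.
by rewrite [LHS]mulrC; apply/eqP; rewrite eqr_div // -e mulrC.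
Qed.

(** At x this is the cocycle property at (x^-1, p, q). *)
Lemma maps_actM p q k a : a \in maps_gr k ->
  maps_act omega (p * q)%g a = w2 p q k *: maps_act omega p (maps_act omega q a).
Proof.
move=> ak; apply/ffunP => x; rewrite ffunE.
rewrite (maps_actE _ _ _ (maps_act_gr q ak)) !(maps_actE _ _ _ ak) invMg mulgA.
rewrite !scalerA; congr (_ *: _).
have nz := omega2_neq0 omegaP.
have := omega2_cocycle omegaP x^-1%g p q k.
rewrite invMg invgK => e.
by rewrite -invfM (mulrC (w2 x^-1%g p _)) e (invfM (w2 _ _ _)) [RHS]mulrCA mulfV ?mulr1.
Qed.

Lemma maps_act1 k a : a \in maps_gr k -> maps_act omega 1%g a = a.
Proof.
move=> ak; apply/ffunP => x.
by rewrite (maps_actE _ _ _ ak) invg1 mul1g omega2_1r // invr1 scale1r.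
Qed.

(** In the coordinate h of the value at x, only the component of degree
    x h x^-1 contributes. *)
Lemma maps_gr_direct : directv (\sum_g maps_gr (F := F) (H := H) g).
Proof.
apply/directv_sum_independent => u uP u0 k _; apply/ffunP => x; apply/ffunP => h.
rewrite (_ : (0 : maps F H) x h = 0); last by rewrite !ffunE.
have [hk | hk] := eqVneq (sgval h) (k ^ x)%g; last first.
  exact: (elimT (twgrpalg_grP _ _) (elimT (maps_grP _ _) (uP k isT) x)).
have /ffunP/(_ x)/ffunP/(_ h) := u0.
rewrite sum_ffunE sum_ffunE (bigD1 k) //= big1 => [|l lk].
  by rewrite addr0 => ->; rewrite !ffunE.
apply: (elimT (twgrpalg_grP _ _) (elimT (maps_grP _ _) (uP l isT) x)).
by rewrite hk (inj_eq (@conjg_inj _ x)) eq_sym.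
Qed.

(** * Homogeneous elements supported on a coset *)

Lemma lagr_gr_coset_ext k g a b : a \in Lgr k -> b \in Lgr k -> a g = b g ->
  {in (g *: H)%g, a =1 b}.
Proof.
move=> /lagr_grP[_ aP] /lagr_grP[_ bP] ab x /lcoset_subgP[h ->].
by rewrite aP bP ab.
Qed.

(** Both sides have the same value at g, because a g has degree f and the
    component of degree f is spanned by e_f. *)
Lemma lagr_gr_chi g f a : a \in Lgr (lconj g (sgval f)) ->
  (forall x, x \notin (g *: H)%g -> a x = 0) -> a = a g f *: chi g f.
Proof.
move=> aL a0; apply/ffunP => x.
have [xgH | xgH] := boolP (x \in (g *: H)%g); last first.
  by rewrite ffunE chi_out // scaler0 a0.
have cL : a g f *: chi g f \in Lgr (lconj g (sgval f)).
  exact/memvZ/chi_lagr.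
apply: (lagr_gr_coset_ext aL cL _ xgH).
rewrite ffunE chi_rep; apply: twgrpalg_gr_line.
have /lagr_grP[/maps_grP/(_ g) + _] := aL.
by rewrite conjg_lconj mulVg conjg1.
Qed.

Definition restrict (A : {set gT}) a : maps F H :=
  [ffun x => if x \in A then a x else 0].

(** The equivariance condition relates only values on the same left coset. *)
Lemma restrict_lagr g k a : a \in Lgr k -> restrict (g *: H)%g a \in Lgr k.
Proof.
case/lagr_grP=> /maps_grP ak aP; apply/lagr_grP; split=> [|x h].
  by apply/maps_grP => x; rewrite ffunE; case: ifP => // _; apply: mem0v.
by rewrite !ffunE lcosetMr; case: ifP => // _; rewrite linear0 scaler0.
Qed.

Lemma restrict_lagr_line g k a : a \in Lgr k ->
  exists f, restrict (g *: H)%g a \in <[chi g f]>%VS.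
Proof.
move=> aL; have rL := restrict_lagr g aL.
have out x : x \notin (g *: H)%g -> restrict (g *: H)%g a x = 0.
  by move=> /negbTE xgH; rewrite ffunE xgH.
have [kgH | kgH] := boolP ((k ^ g)%g \in H).
  exists (subg H (k ^ g)%g).
  have kE : k = lconj g (sgval (subg H (k ^ g)%g)).
    by rewrite subgK // /lconj conjgE !mulgA mulgV mul1g mulgK.
  have {}rL : restrict (g *: H)%g a \in Lgr (lconj g (sgval (subg H (k ^ g)%g))).
    by rewrite -kE.
  rewrite (lagr_gr_chi rL out); exact/memvZ/memv_line.
(* The value at g has a degree outside H, so it is 0, and any line will do. *)
exists 1%g; suff -> : restrict (g *: H)%g a = 0 by exact: mem0v.
apply/ffunP => x; have [xgH | /out->] := boolP (x \in (g *: H)%g); last by rewrite ffunE.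
apply: (lagr_gr_coset_ext rL (mem0v _) _ xgH).
have /lagr_grP[/maps_grP/(_ g)/twgrpalg_grP r0 _] := rL.
apply/ffunP => h; rewrite r0 ?ffunE ?ffunE //.
by apply: contraNneq kgH => <-; apply: subgP.
Qed.

Lemma sum_restrict a : \sum_(A in lcosets H [set: gT]) restrict A a = a.
Proof.
apply/ffunP => x; rewrite sum_ffunE (bigD1 (x *: H)%g) /=; last first.
  by apply/lcosetsP; exists x; rewrite ?inE.
rewrite ffunE lcoset_refl big1 ?addr0 // => A /andP[/lcosetsP[g _ ->] gx].
rewrite ffunE; case: ifP => // xg; move: gx; by rewrite (lcoset_eqP xg) eqxx.
Qed.

(** * The monomial decomposition *)
Local Notation line := (chi_line omega gamma).

(** Passing to another representative of the class changes neither the left coset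
    nor the degree. *)
Lemma chi_act g f h :
  exists c, chi (g * (sgval h)^-1)%g (lconj h f) = c *: chi g f.
Proof.
have eH : ((g * (sgval h)^-1) *: H = g *: H)%g.
  by apply/lcoset_eqP; rewrite mem_lcoset mulKg groupV subgP.
have cL := chi_lagr (g * (sgval h)^-1)%g (lconj h f).
have dE : lconj (g * (sgval h)^-1)%g (sgval (lconj h f)) = lconj g (sgval f).
  rewrite (_ : sgval (lconj h f) = lconj (sgval h) (sgval f)) //.
  by rewrite -lconjM mulgKV.
rewrite dE in cL; eexists; apply: (lagr_gr_chi cL) => x.
by rewrite -eH; apply: chi_out.
Qed.

Lemma chi_lineE g f : line (GH_class g f) = <[chi g f]>%VS.
Proof.
apply/eqP; rewrite eqEsubv; apply/andP; split.
  apply/subv_sumP => q /imsetP[h _ ->]; have [c e] := chi_act g f h.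
  rewrite -memvE /= e; exact/memvZ/memv_line.
apply: (sumv_sup (g, f)) => //.
by apply/imsetP; exists 1%g; rewrite ?GH_act1 ?inE.
Qed.

Lemma lagr_gr_sub k a : a \in Lgr k -> a \in L.
Proof. by rewrite !memvE => /subv_trans-> //; apply: (sumv_sup k). Qed.

Lemma lagr_grW k a : a \in Lgr k -> a \in maps_gr k.
Proof. by case/lagr_grP. Qed.

Lemma chi_line_sum : (\sum_O line O)%VS = L.
Proof.
apply/eqP; rewrite eqEsubv; apply/andP; split.
  apply/subv_sumP => O _.
  by rewrite -(GH_reprK O) chi_lineE -memvE (lagr_gr_sub (chi_lagr _ _)).
apply/subv_sumP => k _; apply/subvP => a aL; rewrite -(sum_restrict a); apply: memv_suml => A.
case/lcosetsP=> g _ ->; have [f af] := restrict_lagr_line g aL.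
by apply: subvP af; rewrite -chi_lineE; apply: (sumv_sup (GH_class g f)).
Qed.

Lemma chi_coord g f g' f' : chi g' f' g f != 0 -> GH_class g' f' = GH_class g f.
Proof.
have [/lcoset_subgP[h ->] | /chi_out->] := boolP (g \in (g' *: H)%g); last first.
  by rewrite ffunE eqxx.
rewrite chiE !ffunE => nz; apply/eqP/GH_classP; exists h^-1%g.
have [-> | fe] := eqVneq f (h^-1 * f' * h)%g; last first.
  by rewrite (negbTE fe) scaler0 eqxx in nz.
by rewrite /GH_act /lconj /= !invgK.
Qed.

(** If (g, f) represents the class O, the coefficient of e_f in the value at g
    vanishes on the lines of all other classes by [chi_coord]. *)
Lemma chi_line_independent (u : GxH H -> maps F H) :
  (forall O, u O \in line O) -> \sum_O u O = 0 -> forall O, u O = 0.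
Proof.
move=> uP u0 O.
have uE Q : exists c, u Q = c *: chi (GH_repr Q).1 (GH_repr Q).2.
  by apply/vlineP; rewrite -chi_lineE GH_reprK uP.
have /ffunP/(_ (GH_repr O).1)/ffunP/(_ (GH_repr O).2) := u0.
rewrite sum_ffunE sum_ffunE (bigD1 O) //= big1 => [|Q QO].
  have [c ->] := uE O; rewrite ffunE chi_rep addr0 !ffunE eqxx.
  by rewrite [_ *: _]mulr1 => ->; rewrite scale0r.
have [c ->] := uE Q; rewrite ffunE ffunE.
apply/eqP; apply: contraNT QO => nz; apply/eqP.
rewrite -[Q]GH_reprK -[RHS]GH_reprK; apply: chi_coord.
by apply: contraNneq nz => ->; rewrite scaler0.
Qed.

(** The factor is the coefficient of e_f in the value at p g, which is the inverse
    of a value of omega(-, -; -). *)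
Lemma maps_act_chi p g f :
  exists2 c, c != 0 & maps_act omega p (chi g f) = c *: chi (p * g)%g f.
Proof.
have cL := chi_lagr g f.
have aL := maps_act_lagr_gr p cL; rewrite -lconjM in aL.
have aE x := maps_actE omega p x (lagr_grW cL).
have out x : x \notin (p * g *: H)%g -> maps_act omega p (chi g f) x = 0.
  rewrite aE => xH; rewrite chi_out ?scaler0 //.
  by apply: contra xH; rewrite !mem_lcoset invMg mulgA.
rewrite (lagr_gr_chi aL out); eexists; last reflexivity.
rewrite aE mulKg chi_rep !ffunE eqxx [_ *: _]mulr1 invr_neq0 //.
exact: omega2_neq0.
Qed.

Lemma lagr_twistedYD :
  twistedYD omega L (fun g => L :&: maps_gr g)%VS (maps_act omega).
Proof.
split.
- apply/eqP; rewrite eqEsubv; apply/andP; split; apply/subv_sumP => k _.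
    exact: capvSl.
  apply: (sumv_sup k) => //; apply/subvP => a aL.
  by rewrite memv_cap (lagr_gr_sub aL) (lagr_grW aL).
- apply/directv_sum_independent => u uP; apply/directv_sum_independent.
    exact: maps_gr_direct.
  by move=> k _; have := uP k isT; rewrite memv_cap => /andP[].
- move=> a /memv_sumP[u uP ->]; rewrite linear_sum; apply: eq_bigr => k _.
  exact: maps_act1 (lagr_grW (uP k isT)).
- by move=> g h k a; rewrite memv_cap => /andP[_]; apply: maps_actM.
move=> g k; apply/subvP => _ /memv_imgP[a + ->].
rewrite !memv_cap => /andP[aL ak]; rewrite maps_act_gr // andbT.
have /memv_sumP[u uP ->] := aL; rewrite linear_sum; apply: memv_suml => l _.
exact: lagr_gr_sub (maps_act_lagr_gr g (uP l isT)).
Qed.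

Lemma lagr_monomialYD :
  monomialYD omega L (fun g => L :&: maps_gr g)%VS (maps_act omega) line.
Proof.
split.
- exact: lagr_twistedYD.
- by move=> O; rewrite -(GH_reprK O) chi_lineE dim_vline chi_neq0.
- exact: chi_line_sum.
- apply/directv_sum_independent => u uP u0 O _.
  by apply: chi_line_independent u0 O => O; apply: uP.
- move=> p; exists (perm (@GH_translate_inj _ H p)) => O; rewrite permE.
  rewrite -{1}(GH_reprK O) !chi_lineE limg_line.
  have [c c0 ->] := maps_act_chi p (GH_repr O).1 (GH_repr O).2.
  apply/eqP; rewrite eqEsubv -!memvE memvZ ?memv_line //=.
  apply/vlineP; exists c^-1; by rewrite scalerK.
move=> O; exists (lconj (GH_repr O).1 (sgval (GH_repr O).2)).
rewrite -{1}(GH_reprK O) chi_lineE -memvE memv_cap.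
by have cL := chi_lagr (GH_repr O).1 (GH_repr O).2; rewrite (lagr_gr_sub cL) (lagr_grW cL).
Qed.

End Lagrangian.

Theorem theorem4p4 (R : realType) (gT : finGroupType)
    (omega : gT -> gT -> gT -> R[i]) (omegaP : normalized_3cocycle omega)
    (H : {group gT}) (gamma : [subg H] -> [subg H] -> R[i])
    (gammaP : trivializes omega gamma) :
  (forall g h, chi_line omega gamma (GH_class g h) = <[chi omega gamma g h]>%VS) /\
  monomialYD omega (lagr omega gamma)
    (fun g => lagr omega gamma :&: maps_gr g)%VS
    (maps_act omega)
    (chi_line omega gamma).
Proof. by split; [apply: chi_lineE | apply: lagr_monomialYD]. Qed.
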